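(* For every admissible algebra $\mathcal N$ the following conditions are equivalent. (i) For some (and hence every) $\pi\in\Pi(\mathcal N)$ the hypersurface $S_\pi$ is affinely homogeneous. (ii) For all $\pi,\tilde\pi\in\Pi(\mathcal N)$ the hypersurfaces $S_\pi,S_{\tilde\pi}$ are linearly equivalent. (iii) The group $\mathrm{Aut}(\mathcal N)$ acts transitively on $\Pi(\mathcal N)$. (iv) The group $\mathrm{Aut}(\mathcal N)$ acts transitively on $\Sigma(\mathcal N)$.
   Context: $\mathbb F$ is a field of characteristic $0$; all algebras are associative $\mathbb F$-algebras. An admissible algebra is a commutative nilpotent algebra $\mathcal N$ of finite dimension over $\mathbb F$ whose annihilator $\mathcal N_{[1]}=\{x\in\mathcal N:x\mathcal N=0\}$ has dimension $1$. $\Pi(\mathcal N)$ is the set of all admissible projections, i.e. linear maps $\pi=\pi^2\in\mathrm{End}(\mathcal N)$ with range $\mathcal N_{[1]}$. Put $\exp_1(x)=\sum_{k\ge1}x^k/k!$ for $x\in\mathcal N$, $S_\pi:=\{x\in\mathcal N:\pi(\exp_1x)=0\}$ and $\Sigma(\mathcal N):=\{S_\pi:\pi\in\Pi(\mathcal N)\}$. $S_\pi$ is affinely homogeneous if the group $\mathrm{Aff}(S_\pi)$ of all affine bijections $g$ of $\mathcal N$ with $g(S_\pi)=S_\pi$ acts transitively on $S_\pi$. $S_\pi$ and $S_{\tilde\pi}$ are linearly equivalent if $g(S_\pi)=S_{\tilde\pi}$ for some $g\in\mathrm{GL}(\mathcal N)$. The algebra automorphism group $\mathrm{Aut}(\mathcal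 N)$ acts on $\Pi(\mathcal N)$ by conjugation, $L(\pi)=L\circ\pi\circ L^{-1}$, and on $\Sigma(\mathcal N)$ by $S\mapsto L(S)$ (one has $L(S_\pi)=S_{L(\pi)}$). *)

(* Defs.v *)
From HB Require Import structures.
From mathcomp Require Import all_boot all_order all_algebra.
From mathcomp Require Import classical_sets.

Set Implicit Arguments.
Unset Strict Implicit.
Unset Printing Implicit Defensive.

Import GRing.Theory.
Local Open Scope ring_scope.
Local Open Scope classical_set_scope.

Definition acts_transitively (H X : Type) (act : H -> X -> X)
    (G : set H) (Y : set X) : Prop :=
  forall y z : X, Y y -> Y z -> exists2 g : H, G g & act g y = z.

Section AffineGeometry.
Variables (F : fieldType) (N : vectType F).

Definition GL : set 'End(N) := [set g | bijective g].

Definition affine_map (g : N -> N) : Prop :=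
  exists (A : 'End(N)) (b : N), forall x, g x = A x + b.

Definition Aff (S : set N) : set (N -> N) :=
  [set g | [/\ affine_map g, bijective g & g @` S = S]].

Definition affinely_homogeneous (S : set N) : Prop :=
  acts_transitively (fun (g : N -> N) (x : N) => g x) (Aff S) S.

Definition linearly_equivalent (S S' : set N) : Prop :=
  exists2 g : 'End(N), GL g & g @` S = S'.

End AffineGeometry.

(* Nilpotent algebras have no unit, so MathComp's ring and algebra structures
   do not apply: an algebra is a finite-dimensional space [N] together with a
   bilinear product [mul]. *)
Section AdmissibleAlgebras.
Variables (F : fieldType) (N : vectType F) (mul : {bilinear N -> N -> N}).

(* All products of n + 1 factors vanish for some n. *)
Definition nilpotent_alg : Prop :=
  exists n : nat, forall (x : N) (s : n.-tuple N), foldl mul x s = 0.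

(* The kernel of x |-> (y |-> x y); see [mem_ann]. *)
Definition ann : {vspace N} := lker (linfun (fun x : N => linfun (mul x))).

Lemma mem_ann (x : N) : reflect (forall y, mul x y = 0) (x \in ann).
Proof.
have lin : linear (fun x : N => linfun (mul x)).
  move=> a u v; apply/lfunP => w.
  by rewrite add_lfunE scale_lfunE !lfunE /= linearPl.
pose h : {linear N -> 'Hom(N, N)} :=
  HB.pack (fun x : N => linfun (mul x)) (GRing.isLinear.Build _ _ _ _ _ lin).
rewrite /ann memv_ker (lfunE h) /=.
apply: (iffP eqP) => [x0 y | x0].
  by have /lfunP/(_ y) := x0; rewrite !lfunE.
by apply/lfunP => y; rewrite !lfunE /= x0.
Qed.

Record admissible : Prop := Admissible {
  admissible_assoc : associative mul;
  admissible_comm : commutative mul;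
  admissible_nilpotent : nilpotent_alg;
  admissible_dim_ann : \dim ann = 1%N }.

(* Meaningful for k >= 1 only, N having no unit. *)
Definition alg_pow (x : N) (k : nat) : N := iter k.-1 (mul x) x.

(* The exponential series without its constant term.  It may be cut at
   k = dim N, since higher powers vanish: see [exp1_stable]. *)
Definition exp1 (x : N) : N :=
  \sum_(1 <= k < (\dim {:N}).+1) (k`!%:R : F)^-1 *: alg_pow x k.

Lemma alg_pow_eq0 (x : N) (k : nat) :
  admissible -> (\dim {:N} < k)%N -> alg_pow x k = 0.
Proof.
case=> _ mulC [n nil_mul] _; case: k => // k.
rewrite ltnS /alg_pow /= => le_dim_k.
have iter_foldl m z : iter m (mul x) z = foldl mul z (nseq m x).
  by elim: m z => //= m IHm z; rewrite -IHm (mulC z) -iterSr.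
pose V m := iter m (lfun_img (linfun (mul x))) fullv.
have V_iter m z : iter m (mul x) z \in V m.
  elim: m => [|m IHm]; first exact: memvf.
  have -> : iter m.+1 (mul x) z = linfun (mul x) (iter m (mul x) z).
    by rewrite lfunE.
  exact: memv_img.
have V_sub m : (V m.+1 <= V m)%VS.
  elim: m => [|m IHm]; first exact: subvf.
  exact: limgS.
have V_ex m v : v \in V m -> exists z, v = iter m (mul x) z.
  elim: m v => [|m IHm] v; first by exists v.
  case/memv_imgP => u /IHm[z ->] ->; exists z.
  by rewrite lfunE.
have Vn0 m : (n <= m)%N -> V m = 0%VS.
  move=> le_n_m; apply/eqP; rewrite -subv0; apply/subvP => v /V_ex[z ->].
  rewrite -(subnKC le_n_m) iterD iter_foldl.
  by rewrite (nil_mul _ (nseq_tuple n x)) memv0.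
have V_dim m : (\dim (V m) <= \dim {:N} - m)%N.
  elim: m => [|m IHm]; first by rewrite subn0 dimvS ?subvf.
  have [eqV | neqV] := eqVneq (V m.+1) (V m).
    have V_stab j : V (m + j)%N = V m.
      elim: j => [|j IHj]; first by rewrite addn0.
      by rewrite addnS -[LHS]/(lfun_img _ (V (m + j)%N)) IHj -[RHS]eqV.
    by rewrite eqV -(V_stab n) Vn0 ?leq_addl // dimv0.
  have ltV : (\dim (V m.+1) < \dim (V m))%N.
    by rewrite (ltn_leqif (dimv_leqif_eq (V_sub m))).
  by rewrite subnS -ltnS (leq_trans ltV) // (leq_trans IHm) // leqSpred.
have /eqP V0 : V k == 0%VS.
  by rewrite -dimv_eq0 -leqn0 (leq_trans (V_dim k)) // leqn0 subn_eq0.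
by apply/eqP; rewrite -memv0 -V0 V_iter.
Qed.

Lemma exp1_stable (x : N) (n : nat) : admissible -> (\dim {:N} <= n)%N ->
  \sum_(1 <= k < n.+1) (k`!%:R : F)^-1 *: alg_pow x k = exp1 x.
Proof.
move=> adm le_dn; rewrite (big_cat_nat (n := (\dim {:N}).+1)) //=.
rewrite [X in _ + X]big_nat_cond [X in _ + X]big1 ?addr0 // => k.
by rewrite andbT => /andP[lt_dk _]; rewrite alg_pow_eq0 ?scaler0.
Qed.

Definition admissible_proj : set 'End(N) :=
  [set p | (p \o p)%VF = p /\ limg p = ann].

Definition hypersurface (p : 'End(N)) : set N := [set x | p (exp1 x) = 0].

Definition hypersurfaces : set (set N) :=
  [set hypersurface p | p in admissible_proj].

Definition Aut_alg : set 'End(N) :=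
  [set L | bijective L /\ {morph L : x y / mul x y}].

(* For bijective L, [L^-1] is the two-sided inverse. *)
Definition conj_act (L p : 'End(N)) : 'End(N) := (L \o p \o L^-1)%VF.

Definition image_act (L : 'End(N)) (S : set N) : set N := L @` S.

End AdmissibleAlgebras.

(* Main.v *)
From HB Require Import structures.
Require Import Defs.
From mathcomp Require Import all_boot all_order all_algebra.
From mathcomp Require Import classical_sets.

Set Implicit Arguments.
Unset Strict Implicit.
Unset Printing Implicit Defensive.

Import GRing.Theory.
Local Open Scope ring_scope.
Local Open Scope classical_set_scope.

(* Since exp1 (c + x) = exp1 c + exp c * exp1 x, the translate S_p - c by a point
   c of S_p is the hypersurface of the admissible projection x |-> p (exp c * x);
   as the form (x, y) |-> p (x y) has radical ann and exp1 is surjective, every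
   admissible projection is of this kind.  Hence all the S_q are translates of
   one another by their own points, and affine homogeneity, linear equivalence
   and transitivity on hypersurfaces imply one another.

   The remaining point is that a linear bijection g from S_p onto S_q is an
   algebra automorphism with g p = q g.  Write p = lam z0 and q = mu z0 with z0
   spanning ann.  Expanding mu (exp1 (g x)) = 0 along x = t y - lam (exp1 (t y)) z0
   up to t^3 gives mu g = nu lam, and shows that g preserves the quadratic forms
   up to nu, and the cubic forms up to nu and a multiple of the quadratic form by
   a linear form l, which measures how far g z0 is from ann.  Multiplications are
   nilpotent, hence traceless; taking traces gives (dim N + 1) l = 0.  Then g
   preserves quadratic and cubic forms up to nu, and these determine the product
   because the quadratic form is nondegenerate modulo ann. *)

(** * Unitization and the exponential *)

Section Unitization.
Variables (F : fieldType) (N : vectType F) (mul : {bilinear N -> N -> N}).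

(** [F + N] with a unit adjoined, where [x ^+ 0] and the binomial theorem make sense. The two laws
    are parameters of the type so that its ring instances can be inferred from the type alone. *)
Definition unitization (mulA : associative mul) (mulC : commutative mul) : Type :=
  (F^o * N)%type.

Variables (mulA : associative mul) (mulC : commutative mul).
Local Notation U := (unitization mulA mulC).

HB.instance Definition _ := GRing.Lmodule.on U.

Definition unitization_one : U := (1, 0).
Definition unitization_mul (u v : U) : U :=
  (u.1 * v.1, u.1 *: v.2 + v.1 *: u.2 + mul u.2 v.2).

Lemma unitization_mulC : commutative unitization_mul.
Proof.
move=> u v; rewrite /unitization_mul mulrC (mulC v.2).
by rewrite (addrC (v.1 *: _)).
Qed.

Lemma unitization_mulA : associative unitization_mul.
Proof.
move=> [a x] [b y] [c z]; rewrite /unitization_mul /=; congr pair.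
  by rewrite mulrA.
rewrite !linearDl !linearDr /= !linearZl_LR !linearZr_LR /= mulA !scalerDr !scalerA.
by rewrite !addrA (mulrC c a) (mulrC c b) [LHS](ACl (1*2*4*6*3*5*7)).
Qed.

Lemma unitization_mul1 : left_id unitization_one unitization_mul.
Proof.
by case=> a x; rewrite /unitization_mul /= mul1r scale1r scaler0 linear0l !addr0.
Qed.

Lemma unitization_mulDl : left_distributive unitization_mul +%R.
Proof.
move=> [a x] [b y] [c z]; rewrite /unitization_mul /=; congr pair => /=.
  by rewrite mulrDl.
by rewrite linearDl /= scalerDl scalerDr !addrA [LHS](ACl (1*3*5*2*4*6)).
Qed.

Lemma unitization_one_neq0 : unitization_one != 0.
Proof. by apply/eqP => -[/eqP]; rewrite oner_eq0. Qed.

HB.instance Definition _ := GRing.Zmodule_isComNzRing.Build U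
  unitization_mulA unitization_mulC unitization_mul1 unitization_mulDl
  unitization_one_neq0.

Lemma unitization_scaleAl (a : F) (u v : U) : a *: (u * v) = a *: u * v.
Proof.
case: u v => [b x] [c y]; congr pair => /=; first by rewrite -mulrA.
by rewrite linearZl_LR !scalerDr !scalerA (mulrC a c).
Qed.

HB.instance Definition _ := GRing.Lmodule_isLalgebra.Build F U unitization_scaleAl.
HB.instance Definition _ := GRing.Lalgebra_isComAlgebra.Build F U.

Definition of_alg (x : N) : U := (0, x).

Lemma of_algD x y : of_alg (x + y) = of_alg x + of_alg y.
Proof. by congr pair; rewrite /= addr0. Qed.

Lemma of_algZ a x : of_alg (a *: x) = a *: of_alg x.
Proof. by congr pair; rewrite /= /GRing.scale /= mulr0. Qed.

Lemma of_algM x y : of_alg (mul x y) = of_alg x * of_alg y.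
Proof. by congr pair; rewrite /= ?mul0r // !scale0r !add0r. Qed.

Lemma of_alg_inj : injective of_alg.
Proof. by move=> x y []. Qed.

Lemma of_alg_sum (I : Type) (r : seq I) (P : pred I) (f : I -> N) :
  of_alg (\sum_(i <- r | P i) f i) = \sum_(i <- r | P i) of_alg (f i).
Proof. by rewrite (big_morph of_alg of_algD (erefl : of_alg 0 = 0)). Qed.

Lemma of_alg_pow x k : (0 < k)%N -> of_alg (alg_pow mul x k) = of_alg x ^+ k.
Proof.
case: k => // k _; rewrite /alg_pow /=; elim: k => [|k IHk] /=; first by rewrite expr1.
by rewrite of_algM IHk -exprS.
Qed.

End Unitization.

Section TruncatedExponential.
Variables (F : fieldType) (F_char0 : [pchar F] =i pred0) (A : comAlgType F).

Definition exp_trunc (m : nat) (x : A) : A := \sum_(k < m) (k`!%:R : F)^-1 *: x ^+ k.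

Lemma fact_neq0_char0 k : (k`!%:R : F) != 0.
Proof. by have /pcharf0P-> := F_char0; rewrite -lt0n fact_gt0. Qed.

(** Cauchy product: the binomial theorem yields the terms with [i + j < m], and the others vanish
    because [n + n <= m <= i + j] forces [n <= i] or [n <= j]. *)
Lemma exp_truncD n m (x y : A) : x ^+ n = 0 -> y ^+ n = 0 -> (n + n <= m)%N ->
  exp_trunc m (x + y) = exp_trunc m x * exp_trunc m y.
Proof.
move=> xn0 yn0 le_nm; pose e (z : A) k := (k`!%:R : F)^-1 *: z ^+ k.
have e0 i j : (m <= i + j)%N -> e x i * e y j = 0.
  move=> le_m; rewrite /e -scalerAl -scalerAr.
  have pow0 (z : A) k : z ^+ n = 0 -> (n <= k)%N -> z ^+ k = 0.
    by move=> zn0 le_nk; rewrite -(subnK le_nk) exprD zn0 mulr0.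
  have [le_ni|lt_in] := leqP n i; first by rewrite (pow0 x) // mul0r !scaler0.
  rewrite (pow0 y) ?mulr0 ?scaler0 //.
  by rewrite -(leq_add2l i) (leq_trans _ le_m) // (leq_trans _ le_nm) // leq_add2r ltnW.
have eD k : e (x + y) k = \sum_(i < k.+1) e x (k - i)%N * e y i.
  rewrite /e exprDn scaler_sumr; apply: eq_bigr => i _.
  have le_ik : (i <= k)%N by rewrite -ltnS.
  rewrite -scalerAl -scalerAr !scalerA -scaler_nat scalerA; congr (_ *: _).
  have bin_neq0 : ('C(k, i)%:R : F) != 0.
    by have /pcharf0P-> := F_char0; rewrite -lt0n bin_gt0.
  by rewrite -(bin_fact le_ik) !natrM invfM mulrAC mulVf // mul1r invfM mulrC.
pose G i j := e x i * e y j.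
(* Here [k] is the total degree and [i] the exponent of [y]; the inner range is widened to [m] so
   that the two sums can be exchanged. *)
transitivity (\sum_(0 <= k < m) \sum_(0 <= i < m | (i <= k)%N) G (k - i)%N i).
  rewrite big_mkord; apply: eq_bigr => k _; rewrite -/(e _ k) eD.
  by rewrite -(big_mkord predT (fun i => G (k - i)%N i)) (big_nat_widen _ _ m).
rewrite (exchange_big_dep predT) //=.
transitivity (\sum_(0 <= i < m) \sum_(0 <= j < m) G j i).
  apply: eq_big_nat => i /andP[_ lt_im].
  transitivity (\sum_(i <= k < m) G (k - i)%N i).
    rewrite [RHS](big_nat_widenl _ 0) //; apply: eq_bigl => k; rewrite ?andbT //.
  rewrite -{1}[i]add0n big_addn (@big_cat_nat _ _ _ (m - i) 0 m) ?leq_subr //=.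
  rewrite [X in _ = _ + X]big_nat_cond [X in _ = _ + X]big1 ?addr0.
    by apply: eq_bigr => k _; rewrite addnK.
  by move=> j; rewrite andbT => /andP[le_j _]; apply: e0; rewrite addnC -leq_subLR.
rewrite exchange_big /exp_trunc big_distrl /= big_mkord; apply: eq_bigr => i _.
by rewrite big_distrr big_mkord.
Qed.

End TruncatedExponential.

(** * Admissible algebras and translation of hypersurfaces *)

Lemma linfunE (F : fieldType) (U V : vectType F) (f : U -> V) :
  linear f -> linfun f =1 f.
Proof.
move=> lin_f x.
pose h : {linear U -> V} := HB.pack f (GRing.isLinear.Build _ _ _ _ _ lin_f).
exact: (lfunE h).
Qed.

Section AdmissibleAlgebra.
Variables (F : fieldType) (N : vectType F) (mul : {bilinear N -> N -> N}).
Hypothesis N_adm : admissible mul.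

Let mulA : associative mul := admissible_assoc N_adm.
Let mulC : commutative mul := admissible_comm N_adm.

(** The ascending annihilator series, whose level 1 is the annihilator; it serves as the induction
    parameter in nilpotency arguments. *)
Fixpoint ann_level (m : nat) (x : N) : Prop :=
  if m is m'.+1 then forall y, ann_level m' (mul x y) else x = 0.

Lemma ann_level_top : exists m, forall x, ann_level m x.
Proof.
have [n nil_mul] := admissible_nilpotent N_adm; exists n => x.
have {nil_mul} := nil_mul x; elim: n x => [|n IHn] x nil_x.
  exact: nil_x [tuple].
move=> y; apply: IHn => s.
exact: nil_x [tuple of y :: s].
Qed.

(** Keep multiplying by factors with nonzero product until the annihilator is reached: nilpotency
    bounds their number and associativity merges them into one. *)
Lemma mul_in_ann (x : N) : x != 0 ->
  x \in ann mul \/ exists2 y, mul x y \in ann mul & mul x y != 0.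
Proof.
have [m /(_ x)] := ann_level_top.
elim: m x => [|m IHm] x /= lvl_x x_neq0; first by rewrite lvl_x eqxx in x_neq0.
have [|x_notin] := boolP (x \in ann mul); [by left | right].
have [y xy_neq0] : exists y, mul x y != 0.
  have : limg (linfun (mul x)) != 0%VS.
    apply: contra x_notin => /eqP img0; apply/mem_ann => y.
    by apply/eqP; rewrite -memv0 -img0 -[mul x y](lfunE (mul x)) memv_img ?memvf.
  have := memv_pick (limg (linfun (mul x))); rewrite -vpick0.
  by case/memv_imgP => y _ ->; rewrite lfunE; exists y.
have [xy_ann|[w xyw_ann xyw_neq0]] := IHm _ (lvl_x y) xy_neq0; first by exists y.
by exists (mul y w); rewrite mulA.
Qed.

Lemma exp1_head (x : N) : exists w, exp1 mul x = x + mul x w.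
Proof.
(* The cut-off is raised by one so that the term [k = 1] can be split off in every dimension. *)
rewrite -(@exp1_stable _ _ _ _ (\dim {:N}).+1) // big_nat_recl //=.
exists (\sum_(1 <= k < (\dim {:N}).+1) (k.+1`!%:R : F)^-1 *: alg_pow mul x k).
rewrite /alg_pow /= invr1 scale1r linear_sumr; congr (_ + _).
apply: eq_big_nat => -[|k] //= _.
by rewrite linearZr_LR.
Qed.

Lemma exp1_ann (z : N) : z \in ann mul -> exp1 mul z = z.
Proof. by move/mem_ann=> z_ann; have [w ->] := exp1_head z; rewrite z_ann addr0. Qed.

Lemma exp10 : exp1 mul 0 = 0.
Proof. by rewrite exp1_ann ?mem0v. Qed.

Hypothesis F_char0 : [pchar F] =i pred0.

(** This is multiplicativity of the exponential in the unitization, where it equals [1 + exp1 x]. *)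
Lemma exp1D (x y : N) :
  exp1 mul (x + y) = exp1 mul x + exp1 mul y + mul (exp1 mul x) (exp1 mul y).
Proof.
pose n := (\dim {:N}).+1; pose e := @of_alg _ _ mul mulA mulC.
have nil_e z : e z ^+ n = 0 by rewrite -of_alg_pow // alg_pow_eq0.
have exp_e z : exp_trunc (n + n).+1 (e z) = 1 + e (exp1 mul z).
  rewrite -(@exp1_stable _ _ _ _ (n + n)) //; last by rewrite /n addSn leqW // leq_addr.
  rewrite /exp_trunc -(big_mkord predT (fun k => (k`!%:R : F)^-1 *: e z ^+ k)).
  rewrite big_ltn // expr0 invr1 scale1r; congr (_ + _); rewrite /e of_alg_sum.
  apply: eq_big_nat => k /andP[k_gt0 _].
  by rewrite of_algZ of_alg_pow.
have := exp_truncD F_char0 (nil_e x) (nil_e y) (leqnSn _).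
rewrite -of_algD !exp_e mulrDl mul1r mulrDr mulr1 -of_algM -!addrA => /addrI.
rewrite addrA -!of_algD => /of_alg_inj ->.
by rewrite addrA (addrC (exp1 mul y)).
Qed.

Lemma exp1Dann (x z : N) : z \in ann mul -> exp1 mul (x + z) = exp1 mul x + z.
Proof.
by move=> z_ann; rewrite exp1D (exp1_ann z_ann) mulC (mem_ann _ _ z_ann) addr0.
Qed.

(* Successive approximation: the error u - exp1 c drops one annihilator level when
   c is replaced by c + (u - exp1 c). *)
Lemma exp1_surj (u : N) : exists c, exp1 mul c = u.
Proof.
have [m top] := ann_level_top.
suff: forall c, ann_level m (u - exp1 mul c) -> exists c', exp1 mul c' = u.
  by move/(_ 0); apply.
move: {top} m; elim=> [|m IHm] c /= lvl_c.
  by exists c; apply/esym/eqP; rewrite -subr_eq0 lvl_c.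
move: lvl_c; have [d dE] : exists d, d = u - exp1 mul c by exists (u - exp1 mul c).
rewrite -dE => lvl_c; apply: (IHm (c + d)).
have [w exp_d] := exp1_head d.
(* With [exp1 d = d + d w], the new error is a multiple of [d], hence one level lower. *)
suff -> : u - exp1 mul (c + d) = mul d (- (w + (exp1 mul c + mul w (exp1 mul c)))).
  exact: lvl_c.
have -> : u = exp1 mul c + d by rewrite dE addrC subrK.
rewrite exp1D exp_d -[X in _ - X]addrA -(addrA d) addrA opprD addrA subrr sub0r.
by rewrite linearNr /=; congr (- _); rewrite !linearDr /= !(mulC (exp1 mul c)) -mulA.
Qed.

Lemma admissible_projE (p : 'End(N)) : admissible_proj mul p <->
  (forall x, p x \in ann mul) /\ (forall z, z \in ann mul -> p z = z).
Proof.
split=> [[pp imgp]|[p_ann p_id]].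
  split=> [x|z]; first by rewrite -imgp memv_img ?memvf.
  by rewrite -imgp => /memv_imgP[x _ ->]; rewrite -comp_lfunE pp.
split; first by apply/lfunP => x; rewrite comp_lfunE p_id.
apply/eqP; rewrite eqEsubv; apply/andP; split; apply/subvP => z.
  by case/memv_imgP => x _ ->.
by move=> z_ann; rewrite -(p_id z) // memv_img ?memvf.
Qed.

Lemma projv_admissible : admissible_proj mul (projv (ann mul)).
Proof.
apply/admissible_projE; split=> [x|z]; last exact: projv_id.
by have := memv_proj (ann mul) x.
Qed.

Lemma ann_generator : exists2 z0, ann mul = <[z0]>%VS & z0 != 0.
Proof.
pose z0 := vpick (ann mul).
have z0_neq0 : z0 != 0 by rewrite vpick0 -dimv_eq0 (admissible_dim_ann N_adm).
exists z0 => //; apply/esym/eqP; rewrite eqEdim -memvE memv_pick.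
by rewrite (admissible_dim_ann N_adm) dim_vline z0_neq0.
Qed.

Variable z0 : N.
Hypotheses (z0_gen : ann mul = <[z0]>%VS) (z0_neq0 : z0 != 0).

Lemma z0_ann : z0 \in ann mul.
Proof. by rewrite z0_gen memv_line. Qed.

Lemma admissible_proj_functional (p : 'End(N)) : admissible_proj mul p ->
  exists2 lam : {scalar N}, (forall x, p x = lam x *: z0) & lam z0 = 1.
Proof.
case/admissible_projE => p_ann p_id.
have lam_lin : scalar (fun x => coord [tuple z0] ord0 (p x)).
  by move=> a x y; rewrite !linearP.
pose lam : {scalar N} := HB.pack (fun x => coord [tuple z0] ord0 (p x))
  (GRing.isLinear.Build _ _ _ _ _ lam_lin).
have lamE x : p x = lam x *: z0.
  have := p_ann x; rewrite z0_gen -span_seq1 => /coord_span {1}->.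
  by rewrite big_ord1.
exists lam => //; apply/eqP; rewrite -subr_eq0.
have /eqP := lamE z0; rewrite p_id ?z0_ann // -{1}[z0]scale1r -subr_eq0 -scalerBl.
by rewrite scaler_eq0 (negbTE z0_neq0) orbF -oppr_eq0 opprB.
Qed.

Section Functional.
Variable lam : {scalar N}.
Hypothesis lam_z0 : lam z0 = 1.

(** An [x] outside [ann] has a nonzero multiple in the line of [z0], where [lam] does not vanish. *)
Lemma functional_form_radical (x : N) :
  (forall y, lam (mul x y) = 0) -> x \in ann mul.
Proof.
move=> lam_x0; apply: contraT => x_notin.
have x_neq0 : x != 0 by apply: contraNneq x_notin => ->; rewrite mem0v.
have [x_ann|[y]] := mul_in_ann x_neq0; first by rewrite x_ann in x_notin.
rewrite z0_gen => /vlineP[a xyE]; have := lam_x0 y.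
by rewrite xyE linearZ /= lam_z0 mulr1 => ->; rewrite scale0r eqxx.
Qed.

(** Dimension count: sending [u] to [lam (mul u _)] has kernel [ann], hence rank [\dim N - 1], and
    its image lies in the space of forms vanishing at [z0]. *)
Lemma functional_form_repr (mu : {scalar N}) : mu z0 = 0 ->
  exists u, forall x, mu x = lam (mul u x).
Proof.
move=> mu_z0.
pose dual (nu : {scalar N}) : 'Hom(N, F^o) := linfun (nu : N -> F^o).
have dualE nu x : dual nu x = nu x by apply: linfunE => a y w; rewrite linearP.
pose phi u : 'Hom(N, F^o) := linfun (fun x => lam (mul u x) : F^o).
have phiE u x : phi u x = lam (mul u x).
  by apply: linfunE => a y w; rewrite linearPr linearP.
have phi_lin : linear phi.
  move=> a u v; apply/lfunP => x.
  by rewrite add_lfunE scale_lfunE !phiE linearPl linearP.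
have ev_lin : linear (fun nu : 'Hom(N, F^o) => nu z0).
  by move=> a nu nu'; rewrite add_lfunE scale_lfunE.
pose Ev (nu : 'Hom(N, F^o)) := nu z0.
have kerPhi : lker (linfun phi) = ann mul.
  apply/vspaceP => u; rewrite memv_ker (linfunE phi_lin); apply/eqP/idP => [phi0|/mem_ann u_ann].
    by apply: functional_form_radical => y; rewrite -phiE phi0 zero_lfunE.
  by apply/lfunP => x; rewrite phiE u_ann linear0 zero_lfunE.
have img_ker : (limg (linfun phi) <= lker (linfun Ev))%VS.
  apply/subvP => _ /memv_imgP[u _ ->]; rewrite memv_ker (linfunE phi_lin) (linfunE ev_lin) phiE mulC.
  by rewrite (mem_ann _ _ z0_ann) linear0.
have dim_dual : \dim {: 'Hom(N, F^o)} = \dim {:N}.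
  by rewrite !dimvf; apply: muln1.
have dim_img := limg_ker_dim (linfun phi) fullv.
rewrite capfv kerPhi (admissible_dim_ann N_adm) in dim_img.
have dim_ker := limg_ker_dim (linfun Ev) fullv.
rewrite capfv dim_dual -dim_img in dim_ker.
(* Evaluation at [z0] is nonzero on [lam], so its kernel has dimension at most [\dim N - 1]. *)
have img_gt0 : (0 < \dim (limg (linfun Ev)))%N.
  rewrite lt0n dimv_eq0; apply/eqP => img0.
  have := memv_img (linfun Ev) (memvf (dual lam)).
  by rewrite img0 (linfunE ev_lin) memv0 /Ev dualE lam_z0 oner_eq0.
have /eqP img_eq : limg (linfun phi) == lker (linfun Ev).
  by rewrite eqEdim img_ker -(leq_add2r (\dim (limg (linfun Ev)))) dim_ker addnC leq_add2l.
have : dual mu \in limg (linfun phi) by rewrite img_eq memv_ker (linfunE ev_lin) dualE mu_z0.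
case/memv_imgP => u _ muE; exists u => x; by rewrite -dualE muE (linfunE phi_lin) phiE.
Qed.

End Functional.

(** Write [mu - lam] as [lam (mul u _)] and choose [c] with [exp1 c = u - lam u *: z0]. The
    annihilator correction gives [lam (exp1 c) = 0] and leaves products unchanged, so
    [lam (exp1 (c + x)) = mu (exp1 x)]. *)
Lemma hypersurface_recenter (p q : 'End(N)) :
    admissible_proj mul p -> admissible_proj mul q ->
  exists2 c, hypersurface mul p c &
    forall x, hypersurface mul q x <-> hypersurface mul p (c + x).
Proof.
move=> p_adm q_adm.
have [lam pE lam_z0] := admissible_proj_functional p_adm.
have [mu qE mu_z0] := admissible_proj_functional q_adm.
have [|u uE] := functional_form_repr lam_z0 (mu := mu \- lam).
  by rewrite /= lam_z0 mu_z0 subrr.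
have [c' c'E] := exp1_surj u; pose c := c' - lam u *: z0.
have z_ann : - (lam u *: z0) \in ann mul by rewrite rpredN rpredZ ?z0_ann.
have cE : exp1 mul c = u - lam u *: z0 by rewrite exp1Dann ?c'E.
have hE (r : 'End(N)) (nu : {scalar N}) x : (forall x, r x = nu x *: z0) ->
    hypersurface mul r x <-> nu (exp1 mul x) = 0.
  move=> rE; rewrite /hypersurface /= rE; split=> [/eqP|->]; last by rewrite scale0r.
  by rewrite scaler_eq0 (negbTE z0_neq0) orbF => /eqP.
have lam_c : lam (exp1 mul c) = 0.
  by rewrite cE linearB /= linearZ /= lam_z0 mulr1 subrr.
exists c => [|x]; first exact/(hE _ _ _ pE).
rewrite (hE _ _ _ pE) (hE _ _ _ qE) exp1D !linearD /= lam_c add0r.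
rewrite cE linearDl /= (mem_ann _ _ z_ann) addr0 -uE /= addrC subrK.
by [].
Qed.

Lemma hypersurface_translate (p : 'End(N)) (c : N) :
    admissible_proj mul p -> hypersurface mul p c ->
  exists2 q, admissible_proj mul q &
    forall x, hypersurface mul q x <-> hypersurface mul p (c + x).
Proof.
move=> /admissible_projE[p_ann p_id] pc.
pose q : 'End(N) := (p + (p \o linfun (mul (exp1 mul c))))%VF.
have qE x : q x = p (x + mul (exp1 mul c) x).
  by rewrite add_lfunE comp_lfunE lfunE linearD.
exists q.
  apply/admissible_projE; split=> [x|z z_ann]; first by rewrite qE.
  by rewrite qE mulC (mem_ann _ _ z_ann) addr0 p_id.
move=> x; rewrite /hypersurface /= qE exp1D !linearD.
by move: pc; rewrite /hypersurface /= => ->; rewrite add0r.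
Qed.

End AdmissibleAlgebra.

(** * Taylor expansion to third order *)

(** The images of the naturals below [size p] are distinct in characteristic 0: more roots than the
    degree allows. *)
Lemma poly_eq0_char0 (F : fieldType) (F_char0 : [pchar F] =i pred0) (p : {poly F}) :
  (forall t, p.[t] = 0) -> p = 0.
Proof.
move=> p0; apply: (@roots_geq_poly_eq0 _ _ [seq i%:R | i <- iota 0 (size p)]).
- by apply/allP => t _; apply/rootP.
- rewrite map_inj_uniq ?iota_uniq // => i j /eqP.
  wlog le_ij : i j / (i <= j)%N => [IH|].
    by case/orP: (leq_total i j) => le_ij; [apply: IH | rewrite eq_sym => /IH->].
  rewrite eq_sym -subr_eq0 -natrB //; have /pcharf0P-> := F_char0.
  by rewrite subn_eq0 => le_ji; apply/eqP; rewrite eqn_leq le_ij.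
by rewrite size_map size_iota.
Qed.

Section TaylorExpansion.
Variables (F : fieldType) (N : vectType F) (mul : {bilinear N -> N -> N}).
Hypothesis N_adm : admissible mul.
Hypothesis F_char0 : [pchar F] =i pred0.

Let mulC : commutative mul := admissible_comm N_adm.

Lemma alg_powZ t (x : N) k : (0 < k)%N ->
  alg_pow mul (t *: x) k = t ^+ k *: alg_pow mul x k.
Proof.
case: k => // k _; rewrite /alg_pow /=; elim: k => [|k IHk] //=.
by rewrite IHk linearZl_LR linearZr_LR /= scalerA -exprS.
Qed.

(** The form is a bare function with a linearity proof so that the induction hypothesis applies to
    [mu (mul u _)] and [mu (mul z _)]. *)
Lemma poly_scalar_alg_pow (mu : N -> F) (u z : N) (a : {poly F}) k : scalar mu ->
  exists P : {poly F}, forall t, mu (alg_pow mul (u + a.[t] *: z) k) = P.[t].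
Proof.
rewrite /alg_pow; move: k.-1 => {}k; elim: k mu => [|k IHk] mu lin_mu /=.
  exists (a * (mu z)%:P + (mu u)%:P) => t.
  by rewrite addrC lin_mu hornerD hornerM !hornerC.
have [|P1 P1E] := IHk (fun x => mu (mul u x)).
  by move=> c x y; rewrite linearPr lin_mu.
have [|P2 P2E] := IHk (fun x => mu (mul z x)).
  by move=> c x y; rewrite linearPr lin_mu.
exists (a * P2 + P1) => t.
by rewrite hornerD hornerM -P1E -P2E (addrC u) linearPl lin_mu.
Qed.

(* The conclusions are the coefficients of t, t^2 and t^3 in the second hypothesis. *)
Lemma exp1_taylor (mu lam : {scalar N}) (u y z : N) : lam y = 0 ->
    (forall t, mu (exp1 mul (t *: u - lam (exp1 mul (t *: y)) *: z)) = 0) ->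
  [/\ mu u = 0, mu (mul u u) = mu z * lam (mul y y) &
      mu (mul u (mul u u)) =
        mu z * lam (mul y (mul y y)) + 3%:R * (mu (mul u z) * lam (mul y y))].
Proof.
move=> lam_y mu0; have [n le_n] : exists n, (\dim {:N} <= n.+3)%N.
  by exists (\dim {:N}); rewrite 2?leqW.
have fact0 := fact_neq0_char0 F_char0.
(* Since [lam y = 0] kills the linear term, [lam (exp1 (t *: y))] is [t ^+ 2 * h.[t]]. *)
pose h : {poly F} := \poly_(i < n.+2) ((i.+2`!%:R)^-1 * lam (alg_pow mul y i.+2)).
have hE t : lam (exp1 mul (t *: y)) = t ^+ 2 * h.[t].
  rewrite -(exp1_stable _ N_adm le_n).
  rewrite (big_ltn (isT : (1 < n.+4)%N)) linearD /= {1}/alg_pow /= !linearZ /= lam_y !mulr0 add0r.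
  rewrite -[2%N]/(0 + 2)%N big_addn subn2 /= big_mkord linear_sum horner_poly big_distrr /=.
  apply: eq_bigr => i _; rewrite addn2 alg_powZ // !linearZ /=.
  have -> : t ^+ i.+2 = t ^+ i * t ^+ 2 by rewrite -exprD addn2.
  by rewrite add0n mulrCA [RHS]mulrA [RHS]mulrAC (mulrC (t ^+ i)).
(* Chosen so that the argument of [exp1] becomes [t *: (u + a.[t] *: z)], with [a] divisible by
   ['X]. *)
pose a : {poly F} := - ('X * h).
have XE t : t *: u - lam (exp1 mul (t *: y)) *: z = t *: (u + a.[t] *: z).
  by rewrite hE /a hornerN hornerM hornerX scaleNr scalerBr scalerA expr2 mulrA.
pose P1 := (mu u)%:P + a * (mu z)%:P.
have P1E t : mu (alg_pow mul (u + a.[t] *: z) 1) = P1.[t].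
  by rewrite /alg_pow /= linearD linearZ /= hornerD hornerM !hornerC.
pose P2 := (mu (mul u u))%:P + 2%:R *: (a * (mu (mul u z))%:P) + a ^+ 2 * (mu (mul z z))%:P.
have P2E t : mu (alg_pow mul (u + a.[t] *: z) 2) = P2.[t].
  rewrite /alg_pow /= !linearDl !linearDr /= !linearZl_LR !linearZr_LR /= !linearD !linearZ /= (mulC z u).
  rewrite !hornerD hornerZ !hornerM !hornerC.
  by rewrite mulr_natl mulr2n -!mulrA !addrA.
have [P1' P1'E] : exists P, P = P1 by exists P1.
have [P2' P2'E] : exists P, P = P2 by exists P2.
have lin_mu : scalar mu by move=> c v w; rewrite linearP.
have [P3 P3E] := poly_scalar_alg_pow u z a 3 lin_mu.
have [Q QE] : exists Q : {poly F}, forall t,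
    mu (\sum_(4 <= k < n.+4) (k`!%:R : F)^-1 *: alg_pow mul (t *: (u + a.[t] *: z)) k)
    = t ^+ 4 * Q.[t].
  elim: n.+4 => [|m [Q QE]]; first by exists 0 => t; rewrite big_geq // linear0 horner0 mulr0.
  have [lt_m4|le_4m] := ltnP m 4.
    by exists 0 => t; rewrite big_geq // linear0 horner0 mulr0.
  have [P PE] := poly_scalar_alg_pow u z a m lin_mu.
  exists (Q + (m`!%:R)^-1 *: ('X^(m - 4) * P)) => t.
  rewrite big_nat_recr //= linearD QE linearZ /= alg_powZ ?(leq_trans _ le_4m) //.
  rewrite linearZ /= PE hornerD hornerZ hornerM hornerXn mulrDr; congr (_ + _).
  by rewrite [RHS]mulrCA [t ^+ 4 * _]mulrA -exprD subnKC.
have muD x v : mu (x + v) = mu x + mu v by rewrite linearD.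
have muZ c x : mu (c *: x) = c * mu x by rewrite linearZ.
(* The hypothesis divided by [t]: the coefficients of degree 0, 1, 2 here are those of [t], [t^2],
   [t^3] there. *)
have zero : P1' + 2`!%:R^-1 *: ('X * P2') + 3`!%:R^-1 *: ('X^2 * P3) + 'X^3 * Q = 0.
  apply: (@mulfI _ 'X); rewrite ?polyX_eq0 // mulr0; apply: (poly_eq0_char0 F_char0) => t.
  have := mu0 t; rewrite XE -(exp1_stable _ N_adm le_n).
  rewrite (big_ltn (isT : (1 < n.+4)%N)) (big_ltn (isT : (2 < n.+4)%N)).
  rewrite (big_ltn (isT : (3 < n.+4)%N)) 3!muD QE 3!muZ.
  have powZ k v : alg_pow mul (t *: v) k.+1 = t ^+ k.+1 *: alg_pow mul v k.+1.
    exact: alg_powZ.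
  rewrite !powZ 3!muZ P1E P2E -P1'E -P2'E P3E => mu_t.
  have XnE k (P : {poly F}) : ('X^k * P).[t] = t ^+ k * P.[t] by rewrite hornerM hornerXn.
  rewrite hornerM hornerX 3!hornerD 2!hornerZ 2!XnE hornerM hornerX -[RHS]mu_t.
  rewrite !exprS !expr0 !mulr1 invr1 mul1r !mulrDr -!addrA.
  by rewrite !(mulrCA _ (_^-1)) -!mulrA.
have h0 : h`_0 = 2%:R^-1 * lam (mul y y) by rewrite coef_poly.
have h1 : h`_1 = 6%:R^-1 * lam (mul y (mul y y)) by rewrite coef_poly.
have aE k : a`_k.+1 = - h`_k by rewrite coefN coefXM.
have a0 : a`_0 = 0 by rewrite coefN coefXM oppr0.
have aa k : (k < 2)%N -> (a ^+ 2)`_k = 0.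
  by move=> lt_k2; rewrite sqrrN exprMn coefXnM lt_k2.
have P3_0 : P3`_0 = mu (mul u (mul u u)).
  by rewrite -horner_coef0 -P3E horner_coef0 a0 scale0r addr0.
have coefs k : P1'`_k + 2%:R^-1 * ('X * P2')`_k + 6%:R^-1 * ('X^2 * P3)`_k + ('X^3 * Q)`_k = 0.
  by rewrite -!coefZ -!coefD zero coef0.
have n2 : 2%:R != 0 :> F := fact0 2.
have n6 : 6%:R != 0 :> F := fact0 3.
(* The factor 3 in the cubic identity is [6 / 2]: the 6 clears [1 / 3!] and the 2 comes from
   [h0]. *)
have := coefs 0; have := coefs 1; have := coefs 2.
rewrite !coefXnM !coefXM /= !mulr0 !addr0 P1'E P2'E P3_0.
rewrite !coefD !coefZ !coefMC !coefC /= !aa // !aE a0 h0 h1 !mul0r !addr0 ?add0r.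
have n3 : 3%:R != 0 :> F by apply: contraNneq n6 => n3_0; rewrite (natrM _ 2 3) n3_0 mulr0.
have inv2 : 2%:R^-1 = 6%:R^-1 * 3%:R :> F.
  by rewrite (natrM _ 2 3) invfM -mulrA mulVf // mulr1.
move=> + + mu_u; rewrite mulr0 addr0 mulKf // {1}inv2.
rewrite !mulNr -!mulrA -!mulrN -!mulrDr => eq3 eq2; split=> //.
  move/eqP: eq2; rewrite mulf_eq0 invr_eq0 (negbTE n2) /= addrC mulrN subr_eq0 => /eqP->.
  exact: mulrC.
move/eqP: eq3; rewrite mulf_eq0 invr_eq0 (negbTE n6) /= addrC !mulrN.
rewrite -opprD subr_eq0 => /eqP->.
by rewrite mulrC (mulrC (mu (mul u z))).
Qed.

End TaylorExpansion.

(** * Traces of nilpotent maps *)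

(** The characteristic polynomial divides a power of ['X], so it is itself a power of ['X], and its
    subleading coefficient, minus the trace, is zero. *)
Lemma mxtrace_nilpotent (F : fieldType) (n : nat) (A : 'M[F]_n) (k : nat) :
  (forall u : 'rV_n, iter k (fun v => v *m A) u = 0) -> \tr A = 0.
Proof.
case: n A => [|n] A nilA; first by rewrite /mxtrace big_ord0.
have Ak0 : A ^+ k = 0.
  apply/row_matrixP => i; rewrite row0 -(nilA (row i 1%:M)).
  have iterE u : iter k (fun v => v *m A) u = u *m A ^+ k.
    elim: k {nilA} u => [|k IHk] u; first by rewrite expr0 mulmx1.
    by rewrite iterS IHk -mulmxA mulmxE -exprSr.
  by rewrite iterE -row_mul mul1mx.
have [q qE] : exists q, 'X^(k * n.+1) = char_poly A * q.
  pose B : 'M[{poly F}]_n.+1 := map_mx polyC A.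
  have Bk0 : B ^+ k = 0 by rewrite -rmorphXn Ak0 rmorph0.
  have comXB : GRing.comm ('X%:M : 'M_n.+1) B by apply/esym/scalar_mxC.
  (* The determinant of the cofactor of ['X - B] in ['X ^+ k - B ^+ k], which equals ['X ^+ k]. *)
  exists (\det (\sum_(i < k) 'X%:M ^+ (k.-1 - i) * B ^+ i)).
  rewrite -det_mulmx mulmxE /char_poly_mx -(subrXX_comm k comXB) Bk0 subr0 -rmorphXn /= det_scalar.
  by rewrite -exprM.
have /dvdp_exp_XsubCP[j _] : char_poly A %| ('X - 0%:P) ^+ (k * n.+1).
  by rewrite subr0 qE dvdp_mulr.
rewrite subr0 eqp_monic ?char_poly_monic ?monicXn // => /eqP charE.
have := char_poly_trace A (ltn0Sn n); rewrite charE coefXn.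
have := size_char_poly A; rewrite charE size_polyXn => -[->].
by rewrite ltn_eqF // => /eqP; rewrite eq_sym oppr_eq0 => /eqP.
Qed.

Section LinearTrace.
Variables (F : fieldType) (N : vectType F).

Let e := vbasis {:N}.

(** The usual trace when [f] is linear; taking bare functions avoids bundling every sum or
    difference of maps. *)
Definition ltrace (f : N -> N) : F := \sum_i coord e i (f e`_i).

Lemma eq_ltrace (f g : N -> N) : f =1 g -> ltrace f = ltrace g.
Proof. by move=> eq_fg; apply: eq_bigr => i _; rewrite eq_fg. Qed.

Lemma ltrace_rank_one (phi : {scalar N}) (v : N) :
  ltrace (fun x => phi x *: v) = phi v.
Proof.
rewrite [v in RHS](coord_vbasis (memvf v)) linear_sum; apply: eq_bigr => i _.
by rewrite !linearZ /= mulrC.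
Qed.

Lemma ltrace_id : ltrace id = (\dim {:N})%:R.
Proof.
rewrite /ltrace (eq_bigr (fun _ => 1)) => [|i _]; last first.
  by rewrite coord_free ?eqxx // (basis_free (vbasisP _)).
by rewrite sumr_const card_ord.
Qed.

Lemma ltraceD (f g : N -> N) : ltrace (fun x => f x + g x) = ltrace f + ltrace g.
Proof. by rewrite -big_split; apply: eq_bigr => i _; rewrite linearD. Qed.

Lemma ltraceZ a (f : N -> N) : ltrace (fun x => a *: f x) = a * ltrace f.
Proof. by rewrite big_distrr; apply: eq_bigr => i _; rewrite linearZ. Qed.

Lemma ltraceB (f g : N -> N) : ltrace (fun x => f x - g x) = ltrace f - ltrace g.
Proof. by rewrite -sumrB; apply: eq_bigr => i _; rewrite linearB. Qed.

Lemma ltrace_nilpotent (f : {linear N -> N}) (k : nat) :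
  (forall x, iter k f x = 0) -> ltrace f = 0.
Proof.
move=> nilf; pose A : 'M[F]_(\dim {:N}) := \matrix_(i, j) coord e j (f e`_i).
pose vec (u : 'rV[F]_(\dim {:N})) := \sum_i u 0 i *: e`_i.
have vecA u : vec (u *m A) = f (vec u).
  rewrite linear_sum; under [RHS]eq_bigr => i _.
    rewrite linearZ /= (coord_vbasis (memvf (f e`_i))) scaler_sumr; over.
  rewrite exchange_big; apply: eq_bigr => j _; rewrite mxE scaler_suml.
  by apply: eq_bigr => i _; rewrite mxE scalerA.
have -> : ltrace f = \tr A by apply: eq_bigr => i _; rewrite mxE.
apply: (@mxtrace_nilpotent _ _ _ k) => u; apply/rowP => i; rewrite mxE.
have vec_iter : vec (iter k (fun v => v *m A) u) = 0.
  rewrite -(nilf (vec u)); elim: {nilf} k => //= k <-; exact: vecA.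
have := basis_free (vbasisP {:N}) => /freeP/(_ (fun i => iter k (fun v => v *m A) u 0 i)).
by apply.
Qed.

End LinearTrace.

(** * Rigidity of linear equivalences *)

(** Polarization by additivity alone: expanding the diagonal at [x + y] gives [3 * S x y = 0], and
    the failure of [S x] to be additive is [2 * T x y w]. *)
Lemma symmetric_trilinear_eq0 (F : fieldType) (F_char0 : [pchar F] =i pred0)
    (V : zmodType) (K : V -> Prop) (T : V -> V -> V -> F) :
    (forall x y, K x -> K y -> K (x + y)) ->
    (forall x y u w, T (x + y) u w = T x u w + T y u w) ->
    (forall x y w, T x y w = T y x w) -> (forall x y w, T x y w = T x w y) ->
    (forall x, K x -> T x x x = 0) ->
  forall x y w, K x -> K y -> K w -> T x y w = 0.
Proof.
move=> K_add TDl T12 T23 Tdiag.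
have TDm x y u w : T u (x + y) w = T u x w + T u y w by rewrite !(T12 u) TDl.
have TDr x y u w : T u w (x + y) = T u w x + T u w y by rewrite !(T23 u w) TDm.
have natF := fun n => proj1 (pcharf0P F) F_char0 n.
pose S x y := T x x y + T x y y.
have S0 x y : K x -> K y -> S x y = 0.
  move=> Kx Ky; have := Tdiag _ (K_add _ _ Kx Ky).
  have -> : T (x + y) (x + y) (x + y) = 3%:R * S x y.
    rewrite !TDl !TDm !TDr !Tdiag // add0r addr0 (T12 y x x) (T23 y y x) (T12 y x y).
    by rewrite (T23 x y x) /S mulr_natl mulrSr mulr2n !addrA [LHS](ACl (1*3*2*5*4*6)).
  by move/eqP; rewrite mulf_eq0 natF => /eqP.
move=> x y w Kx Ky Kw; apply/eqP.
have : S x (y + w) = S x y + S x w + 2%:R * T x y w.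
  rewrite /S !TDm !TDr (T23 x w y) mulr_natl mulr2n !addrA.
  by rewrite [LHS](ACl (1*3*2*6*4*5)).
rewrite !S0 ?addr0 ?add0r //; last exact: K_add.
by move/esym/eqP; rewrite mulf_eq0 natF.
Qed.

Section Rigidity.
Variables (F : fieldType) (N : vectType F) (mul : {bilinear N -> N -> N}).
Hypothesis N_adm : admissible mul.
Hypothesis F_char0 : [pchar F] =i pred0.

Let mulA : associative mul := admissible_assoc N_adm.
Let mulC : commutative mul := admissible_comm N_adm.

Variable z0 : N.
Hypotheses (z0_gen : ann mul = <[z0]>%VS) (z0_neq0 : z0 != 0).

Lemma iter_mul_nilpotent : exists n, forall x y, iter n (mul x) y = 0.
Proof.
have [n top] := ann_level_top N_adm; exists n => x y.
move: (top y) => {top}; elim: n y => [|n IHn] y lvl_y //.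
by rewrite iterSr; apply: IHn; rewrite mulC; apply: lvl_y.
Qed.

Variables (lam mu : {scalar N}) (g h : {linear N -> N}).
Hypotheses (lam_z0 : lam z0 = 1) (mu_z0 : mu z0 = 1).
Hypotheses (gK : cancel g h) (hK : cancel h g).
Hypothesis g_hypersurface :
  forall x, lam (exp1 mul x) = 0 -> mu (exp1 mul (g x)) = 0.

Let nu := mu (g z0).
(** The projection along [z0] onto the kernel of [lam], which is the tangent hyperplane of the
    hypersurface at 0. *)
Let p x := x - lam x *: z0.

Let muD x y : mu (x + y) = mu x + mu y. Proof. exact: linearD. Qed.
Let lamD x y : lam (x + y) = lam x + lam y. Proof. exact: linearD. Qed.
Let gD x y : g (x + y) = g x + g y. Proof. exact: linearD. Qed.
Let mulDl x y w : mul (x + y) w = mul x w + mul y w. Proof. exact: linearDl. Qed.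

Let z0mul x : mul z0 x = 0.
Proof. exact: (mem_ann _ _ (z0_ann z0_gen)). Qed.

Let mulz0 x : mul x z0 = 0.
Proof. by rewrite mulC z0mul. Qed.

Let lamp x : lam (p x) = 0.
Proof. by rewrite linearB linearZ /= lam_z0 mulr1 subrr. Qed.

Let pE x : x = p x + lam x *: z0.
Proof. by rewrite subrK. Qed.

Let mulp x y : mul (p x) y = mul x y.
Proof. by rewrite linearBl /= linearZl_LR z0mul scaler0 subr0. Qed.

Let ann_multiple x : x \in ann mul -> x = lam x *: z0.
Proof.
by rewrite z0_gen => /vlineP[c ->]; rewrite linearZ /= lam_z0 mulr1.
Qed.

(** The curve [t *: y - lam (exp1 (t *: y)) *: z0] stays on the hypersurface, because adding an
    annihilator element shifts [exp1] by that element. *)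
Lemma hypersurface_jet (y : N) : lam y = 0 ->
  [/\ mu (g y) = 0, mu (mul (g y) (g y)) = nu * lam (mul y y) &
      mu (mul (g y) (mul (g y) (g y))) = nu * lam (mul y (mul y y))
        + 3%:R * (mu (mul (g y) (g z0)) * lam (mul y y))].
Proof.
move=> lam_y; apply: exp1_taylor => // t.
rewrite -!linearZ -linearB /=; apply: g_hypersurface.
rewrite -scaleNr (exp1Dann N_adm F_char0) ?rpredZ ?(z0_ann z0_gen) //.
by rewrite linearD linearZ /= lam_z0 mulr1 subrr.
Qed.

Lemma rigid_functional x : mu (g x) = nu * lam x.
Proof.
rewrite {1}(pE x); move: (p x) (lamp x) => y /hypersurface_jet[mu_y _ _].
by rewrite linearD /= linearZ /= linearD /= linearZ /= mu_y add0r mulrC.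
Qed.

Let nu_neq0 : nu != 0.
Proof.
apply/eqP => nu0; have := rigid_functional (h z0).
by rewrite hK mu_z0 nu0 mul0r; apply/eqP/oner_neq0.
Qed.

Lemma rigid_quadratic x y : lam x = 0 -> lam y = 0 ->
  mu (mul (g x) (g y)) = nu * lam (mul x y).
Proof.
move=> lam_x lam_y; have lam_xy : lam (x + y) = 0 by rewrite linearD /= lam_x lam_y addr0.
have [_ + _] := hypersurface_jet lam_xy.
have [_ q_x _] := hypersurface_jet lam_x; have [_ q_y _] := hypersurface_jet lam_y.
rewrite !linearD /= !linearDl !linearD /= q_x q_y (mulC (g y)) (mulC y).
rewrite !mulrDr !addrA => /addIr; rewrite -!addrA => /addrI.
rewrite -!mulr2n -[LHS]mulr_natl -[RHS]mulr_natl; apply: mulfI.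
by have /pcharf0P-> := F_char0.
Qed.

(** The obstruction to [g z0 = nu *: z0]; [l] is its pairing with [lam (mul _ _)]. Both are to be
    shown to vanish. *)
Let k := h (g z0 - nu *: z0).
Let l x := lam (mul x k).

Let lam_k : lam k = 0.
Proof.
apply/eqP; have := rigid_functional k.
rewrite hK linearB linearZ /= mu_z0 mulr1 subrr => /esym/eqP.
by rewrite mulf_eq0 (negbTE nu_neq0).
Qed.

Let gz0 : g z0 = g k + nu *: z0.
Proof. by rewrite hK subrK. Qed.

Let mu_gz0 x : lam x = 0 -> mu (mul (g x) (g z0)) = nu * l x.
Proof.
move=> lam_x; rewrite gz0 linearDr linearD /= linearZr_LR /= mulz0 scaler0 linear0 addr0.
exact: rigid_quadratic.
Qed.

(** Polarizes the third-order jet: [mu (mul (g y) (g z0))] is [nu * l y], and the factor 3 spreads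
    over the three placements of [l]. *)
Lemma rigid_cubic x y w : lam x = 0 -> lam y = 0 -> lam w = 0 ->
  mu (mul (mul (g x) (g y)) (g w)) = nu * (lam (mul (mul x y) w)
    + (l x * lam (mul y w) + l y * lam (mul x w) + l w * lam (mul x y))).
Proof.
move=> Kx Ky Kw; apply/eqP; rewrite -subr_eq0; apply/eqP.
pose T x y w := mu (mul (mul (g x) (g y)) (g w)) - nu * (lam (mul (mul x y) w)
    + (l x * lam (mul y w) + l y * lam (mul x w) + l w * lam (mul x y))).
apply: (symmetric_trilinear_eq0 F_char0 (K := fun x => lam x = 0) (T := T)) => //.
- by move=> u v Ku Kv; rewrite linearD /= Ku Kv addr0.
- move=> a b u v; rewrite /T /l gD !mulDl muD !lamD.
  rewrite !mulrDl !mulrDr !opprD !addrA.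
  by rewrite [LHS](ACl (1*3*5*7*9*2*4*6*8*10)).
- move=> a b u; rewrite /T (mulC (g b)) (mulC b a); congr (_ - nu * (_ + (_ + _))).
  exact: addrC.
- move=> a b u; rewrite /T -!mulA (mulC (g u)) (mulC u b); congr (_ - nu * (_ + _)).
  by rewrite -!addrA; congr (_ + _); apply: addrC.
- move=> a Ka; have [_ _] := hypersurface_jet Ka.
  rewrite /T -!mulA => ->; rewrite mu_gz0 // mulrDr.
  by rewrite mulr_natl mulrSr mulr2n !mulrDr !mulrA subrr.
Qed.

(** By nondegeneracy modulo [ann] it suffices to pair with [w] through [lam], and [w] may be taken
    in the kernel of [lam] because products ignore [z0]. *)
Lemma rigid_defect x y : lam x = 0 -> lam y = 0 ->
  h (mul (g x) (g y)) - mul x y - l x *: y - l y *: x \in ann mul.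
Proof.
move=> Kx Ky; apply: (functional_form_radical N_adm z0_gen lam_z0) => w0.
set E := (X in mul X _); rewrite mulC -mulp mulC.
move: (p w0) (lamp w0) => {w0} w Kw; rewrite /E; set q := h (mul (g x) (g y)).
have lam_q : lam q = lam (mul x y).
  by apply: (mulfI nu_neq0); rewrite -rigid_functional hK rigid_quadratic.
(* Replacing [q] by [p q] makes [rigid_quadratic] applicable; the resulting term in [g z0] cancels
   [l w * lam (mul x y)] from [rigid_cubic]. *)
have lam_qw : lam (mul q w) =
    lam (mul (mul x y) w) + (l x * lam (mul y w) + l y * lam (mul x w)).
  apply: (mulfI nu_neq0); rewrite -mulp -rigid_quadratic // /p linearB linearZ /= hK.
  rewrite linearBl linearB /= linearZl_LR linearZ /= rigid_cubic // lam_q.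
  rewrite (mulC (g z0)) mu_gz0 // !addrA mulrDr (mulrCA (lam (mul x y))).
  by rewrite (mulrC (l w)) addrK -addrA.
rewrite !linearBl !linearB /= !linearZl_LR !linearZ /= lam_qw.
by rewrite [_ + (_ + _)]addrC addrK [l x * _ + _]addrC addrK subrr.
Qed.

(* [E] is the difference of two nilpotent maps, minus [l x] times the identity and a map
   of trace [l x]; by [rigid_defect] it is also a sum of two rank-one maps of trace 0. *)
Lemma rigid_shift_eq0 x : lam x = 0 -> l x = 0.
Proof.
move=> Kx; pose M y := h (mul (g x) (g y)).
have M_lin : linear M.
  by move=> a u v; rewrite /M linearP linearPr linearP.
pose Ml : {linear N -> N} := HB.pack M (GRing.isLinear.Build _ _ _ _ _ M_lin).
have l_lin : scalar l by move=> a u v; rewrite /l linearPl linearP.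
pose ll : {scalar N} := HB.pack l (GRing.isLinear.Build _ _ _ _ _ l_lin).
pose E y := M y - mul x y - l x *: y - l y *: x.
have E_lin : linear E.
  move=> a u v; rewrite /E M_lin linearPr l_lin !scalerBr scalerDr scalerDl !scalerA.
  rewrite (mulrC (l x)) !opprD !addrA.
  by rewrite [LHS](ACl (1*3*5*7*2*4*6*8)).
have [m nil] := iter_mul_nilpotent.
(* [M] is conjugate under [g] to multiplication by [g x]. *)
have trM : ltrace M = 0.
  apply: (@ltrace_nilpotent _ _ Ml m) => y.
  have -> : iter m M y = h (iter m (mul (g x)) (g y)).
    elim: (m) => [|j IHj] /=; first by rewrite gK.
    by rewrite IHj /M hK.
  by rewrite nil linear0.
have trmul : ltrace (mul x) = 0 by exact: (@ltrace_nilpotent _ _ (mul x) m (nil x)).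
have trE : ltrace E = - ((\dim {:N})%:R + 1) * l x.
  rewrite /E !ltraceB trM trmul ltraceZ ltrace_id (@ltrace_rank_one _ _ ll).
  by rewrite subrr sub0r mulNr mulrDl mul1r opprD mulrC.
have lamEz0 : lam (E z0) = 0.
  have lam_M : lam (M z0) = l x.
    by apply: (mulfI nu_neq0); rewrite -rigid_functional hK mu_gz0.
  have l_z0 : l z0 = 0 by rewrite /l z0mul linear0.
  rewrite /E l_z0 mulz0 scale0r !subr0 linearB linearZ /= lam_M lam_z0.
  by rewrite mulr1 subrr.
pose phi y := lam (E (p y)).
have p_lin : linear p.
  move=> a u v; rewrite /p linearP /= scalerDl -scalerA scalerBr !opprD !addrA.
  by rewrite [LHS](ACl (1*3*2*4)).
have phi_lin : scalar phi by move=> a u v; rewrite /phi p_lin E_lin linearP.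
pose phil : {scalar N} := HB.pack phi (GRing.isLinear.Build _ _ _ _ _ phi_lin).
(* Split [y] as [p y + lam y *: z0]; [rigid_defect] sends the first part into the line of [z0]. The
   traces are [phi z0], zero since [p z0 = 0], and [lam (E z0)]. *)
have EE y : E y = phi y *: z0 + lam y *: E z0.
  rewrite {1}(pE y) addrC E_lin addrC; congr (_ + _).
  by apply: ann_multiple; apply: rigid_defect.
have trE0 : ltrace E = 0.
  rewrite (eq_ltrace EE) ltraceD.
  rewrite (@ltrace_rank_one _ _ phil) ltrace_rank_one lamEz0 addr0 /= /phi.
  pose El : {linear N -> N} := HB.pack E (GRing.isLinear.Build _ _ _ _ _ E_lin).
  by rewrite /p lam_z0 scale1r subrr -[E 0]/(El 0) !linear0.
move: trE0; rewrite trE => /eqP; rewrite mulf_eq0 oppr_eq0 natr1.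
by have /pcharf0P-> := F_char0; move/eqP.
Qed.

(** As [l] vanishes on the kernel of [lam] and products ignore [z0], [k] lies in the radical [ann],
    where [lam k = 0] forces [k = 0]. *)
Lemma rigid_generator : g z0 = nu *: z0.
Proof.
rewrite gz0; suff -> : k = 0 by rewrite linear0 add0r.
have /ann_multiple -> : k \in ann mul; last by rewrite lam_k scale0r.
apply: (functional_form_radical N_adm z0_gen lam_z0) => w.
by rewrite mulC -mulp; apply: rigid_shift_eq0.
Qed.

(** With [l = 0] and [g z0 = nu *: z0] the quadratic and cubic identities hold on all of [N]. They
    put the difference [d] into the radical of the form of [mu], and [mu d = 0] kills it. *)
Lemma rigid_morphism x y : g (mul x y) = mul (g x) (g y).
Proof.
have gp u v : mul (g (p u)) v = mul (g u) v.
  rewrite /p linearB linearZ /= rigid_generator linearBl /= !linearZl_LR /=.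
  by rewrite z0mul !scaler0 subr0.
have gpr u v : mul u (g (p v)) = mul u (g v) by rewrite mulC gp mulC.
have quadratic u v : mu (mul (g u) (g v)) = nu * lam (mul u v).
  by rewrite -gp -gpr rigid_quadratic // mulp mulC mulp mulC.
have cubic u v w : mu (mul (mul (g u) (g v)) (g w)) = nu * lam (mul (mul u v) w).
  rewrite -(gp u) -(gpr _ v) -(gpr _ w) rigid_cubic // !rigid_shift_eq0 // !mul0r !addr0.
  by rewrite mulp (mulC u) mulp (mulC v) (mulC _ (p w)) mulp mulC.
apply/eqP; rewrite -subr_eq0; apply/eqP; set d := _ - _.
have mu_d : mu d = 0 by rewrite linearB /= rigid_functional quadratic subrr.
have : d \in ann mul.
  apply: (functional_form_radical N_adm z0_gen mu_z0) => w.
  by rewrite -[w]hK linearBl linearB /= quadratic cubic subrr.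
rewrite z0_gen => /vlineP[c dE]; move: mu_d.
by rewrite dE linearZ /= mu_z0 mulr1 => ->; rewrite scale0r.
Qed.

End Rigidity.

(** * The equivalences *)

Section Equivalences.
Variables (F : fieldType) (N : vectType F) (mul : {bilinear N -> N -> N}).
Hypothesis N_adm : admissible mul.
Hypothesis F_char0 : [pchar F] =i pred0.

Lemma bijective_lfun_inv (g : 'End(N)) :
  bijective g -> cancel g (g^-1)%VF /\ cancel (g^-1)%VF g.
Proof.
move=> /bij_inj g_inj; have ker0 : lker g == 0%VS by apply/lker0P.
by split; [apply: lker0_lfunK | apply: lker0_lfunVK].
Qed.

Lemma hypersurface0 (p : 'End(N)) : hypersurface mul p 0.
Proof. by rewrite /hypersurface /= (exp10 N_adm) linear0. Qed.

Lemma Aut_alg_exp1 (L : 'End(N)) (x : N) :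
  Aut_alg mul L -> L (exp1 mul x) = exp1 mul (L x).
Proof.
case=> _ LM; rewrite /exp1 linear_sum; apply: eq_bigr => i _.
rewrite linearZ /= /alg_pow; congr (_ *: _); elim: i.-1 => //= j <-.
exact: LM.
Qed.

Lemma Aut_alg_hypersurface (L p : 'End(N)) : Aut_alg mul L ->
  L @` hypersurface mul p = hypersurface mul (conj_act L p).
Proof.
move=> LA; have [LK LVK] := bijective_lfun_inv LA.1.
have conjE x : conj_act L p (exp1 mul (L x)) = L (p (exp1 mul x)).
  by rewrite /conj_act !comp_lfunE -Aut_alg_exp1 // LK.
apply/seteqP; split=> [_ [x px <-]|y qy]; first by rewrite /hypersurface /= conjE px linear0.
exists (L^-1%VF y) => //; rewrite /hypersurface /=; apply: (can_inj LK).
by rewrite linear0 -conjE LVK.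
Qed.

Lemma affinely_homogeneous_recenter (p q : 'End(N)) :
    admissible_proj mul p -> admissible_proj mul q ->
  affinely_homogeneous (hypersurface mul p) -> affinely_homogeneous (hypersurface mul q).
Proof.
move=> p_adm q_adm p_homog y z qy qz.
have [z0 z0_gen z0_neq0] := ann_generator N_adm.
have [c _ qE] := hypersurface_recenter N_adm F_char0 z0_gen z0_neq0 p_adm q_adm.
have [g [[A [b gE]] [g' gK g'K] gS] gyz] :=
  p_homog _ _ ((qE y).1 qy) ((qE z).1 qz).
exists (fun x => g (c + x) - c); last by rewrite /= gyz addrC addKr.
split.
- by exists A, (A c + b - c) => x; rewrite gE linearD /= (addrC (A c)) !addrA.
- exists (fun x => g' (c + x) - c) => x /=.
    by rewrite (addrC c) subrK gK addrC addKr.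
  by rewrite (addrC c (_ - c)) subrK g'K addrC addKr.
apply/seteqP; split=> [_ [x qx <-]|x qx].
  apply/qE; rewrite addrC subrK -gS; exists (c + x) => //; exact/qE.
have : (g @` hypersurface mul p) (c + x) by rewrite gS; apply/qE.
case=> v pv gv; exists (v - c); last by rewrite /= [c + _]addrC subrK gv addrC addKr.
by apply/qE; rewrite addrC subrK.
Qed.

(** An affine symmetry taking 0 to [c], followed by translation by [- c], is linear and carries one
    hypersurface to the other. *)
Lemma affinely_homogeneous_linearly_equivalent (p q : 'End(N)) :
    admissible_proj mul p -> admissible_proj mul q ->
    affinely_homogeneous (hypersurface mul p) ->
  linearly_equivalent (hypersurface mul p) (hypersurface mul q).
Proof.
move=> p_adm q_adm p_homog.
have [z0 z0_gen z0_neq0] := ann_generator N_adm.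
have [c pc qE] := hypersurface_recenter N_adm F_char0 z0_gen z0_neq0 p_adm q_adm.
have [g [[A [b gE]] [g' gK g'K] gS] g0] := p_homog _ _ (hypersurface0 p) pc.
have {}gE x : g x = c + A x by rewrite -g0 !gE linear0 add0r addrC.
exists A.
  exists (fun x => g' (c + x)) => x; first by rewrite -gE gK.
  by apply: (addrI c); rewrite -gE g'K.
apply/seteqP; split=> [_ [x px <-]|x /qE qx].
  by apply/qE; rewrite -gE -gS; exists x.
have : (g @` hypersurface mul p) (c + x) by rewrite gS.
by case=> v pv; rewrite gE => /addrI <-; exists v.
Qed.

Lemma linearly_equivalent_conj (p q : 'End(N)) :
    admissible_proj mul p -> admissible_proj mul q ->
    linearly_equivalent (hypersurface mul p) (hypersurface mul q) ->
  exists2 L : 'End(N), Aut_alg mul L & conj_act L p = q.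
Proof.
move=> p_adm q_adm [g g_bij gS]; have [gK hK] := bijective_lfun_inv g_bij.
have [z0 z0_gen z0_neq0] := ann_generator N_adm.
have [lam pE lam_z0] := admissible_proj_functional z0_gen z0_neq0 p_adm.
have [mu qE mu_z0] := admissible_proj_functional z0_gen z0_neq0 q_adm.
have g_hyp x : lam (exp1 mul x) = 0 -> mu (exp1 mul (g x)) = 0.
  move=> lam_x; have : hypersurface mul q (g x).
    by rewrite -gS; exists x => //; rewrite /hypersurface /= pE lam_x scale0r.
  by rewrite /hypersurface /= qE => /eqP; rewrite scaler_eq0 (negbTE z0_neq0) orbF => /eqP.
exists g.
  by split=> // x y; apply: (rigid_morphism N_adm F_char0 z0_gen lam_z0 mu_z0 gK hK g_hyp).
(* Both sides are multiples of [z0], with coefficients [lam (g^-1 x) * nu] and [mu x]. *)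
apply/lfunP => x; rewrite /conj_act !comp_lfunE pE linearZ /=.
rewrite (rigid_generator N_adm F_char0 z0_gen lam_z0 mu_z0 gK hK g_hyp) scalerA mulrC.
by rewrite -(rigid_functional N_adm F_char0 z0_gen lam_z0 g_hyp) /= hK qE.
Qed.

(** Recentering at [y] and at [z] gives two members of the family; an automorphism [L] between them
    yields the symmetry [z + L (x - y)]. *)
Lemma affinely_homogeneous_of_transitive (p : 'End(N)) :
    acts_transitively (@image_act F N) (Aut_alg mul) (hypersurfaces mul) ->
  admissible_proj mul p -> affinely_homogeneous (hypersurface mul p).
Proof.
move=> trans p_adm y z py pz.
have [q q_adm qE] := hypersurface_translate N_adm F_char0 p_adm py.
have [r r_adm rE] := hypersurface_translate N_adm F_char0 p_adm pz.
have [|| L [L_bij _] LS] := trans (hypersurface mul q) (hypersurface mul r).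
- by exists q.
- by exists r.
have [LK LVK] := bijective_lfun_inv L_bij.
exists (fun x => z + L (x - y)); last by rewrite /= subrr linear0 addr0.
split.
- by exists L, (z - L y) => x; rewrite linearB /= addrCA.
- exists (fun x => y + L^-1%VF (x - z)) => x /=.
    by rewrite [z + _]addrC addrK LK addrC subrK.
  by rewrite [y + _]addrC addrK LVK addrC subrK.
apply/seteqP; split=> [_ [x px <-]|x px].
  apply/rE; rewrite -LS; exists (x - y) => //.
  by apply/qE; rewrite addrC subrK.
have : image_act L (hypersurface mul q) (x - z).
  by rewrite LS; apply/rE; rewrite addrC subrK.
case=> v /qE pv Lv; exists (y + v) => //.
by rewrite [y + v]addrC addrK Lv addrC subrK.
Qed.

End Equivalences.

Theorem mainTheorem5 (F : fieldType) (F_char0 : [pchar F] =i pred0)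
    (N : vectType F) (mul : {bilinear N -> N -> N}) (N_adm : admissible mul) :
  [<-> exists2 p : 'End(N), admissible_proj mul p &
         affinely_homogeneous (hypersurface mul p);
       forall p : 'End(N), admissible_proj mul p ->
         affinely_homogeneous (hypersurface mul p);
       forall p q : 'End(N), admissible_proj mul p -> admissible_proj mul q ->
         linearly_equivalent (hypersurface mul p) (hypersurface mul q);
       acts_transitively (@conj_act F N) (Aut_alg mul) (admissible_proj mul);
       acts_transitively (@image_act F N) (Aut_alg mul) (hypersurfaces mul)].
Proof.
(* The two forms of (i) are separate members of the cycle: some, every, (ii), (iii), (iv), and back
   to some. *)
tfae.
- move=> [p p_adm p_homog] q q_adm.
  exact: affinely_homogeneous_recenter p_adm q_adm p_homog.
- move=> homog p q p_adm q_adm.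
  by apply: affinely_homogeneous_linearly_equivalent => //; apply: homog.
- move=> equiv p q p_adm q_adm.
  by apply: linearly_equivalent_conj => //; apply: equiv.
- move=> trans _ _ [p p_adm <-] [q q_adm <-].
  have [L LA <-] := trans p q p_adm q_adm.
  by exists L => //; apply: Aut_alg_hypersurface.
move=> trans; exists (projv (ann mul)); first exact: projv_admissible.
by apply: affinely_homogeneous_of_transitive => //; apply: projv_admissible.
Qed.
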